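(* Let $K$ be an imaginary quadratic field, and let $L_1=\mathbb{Z}+\mathbb{Z}\tau_1$ and $L_2=\mathbb{Z}+\mathbb{Z}\tau_2$ be lattices in $K$ (with $\tau_1,\tau_2\in K$) of conductors $f_1$ and $f_2$; put $E_i=\mathbb{C}/L_i$, $f=\mathrm{lcm}(f_1,f_2)$ and $\tilde E=\mathbb{C}/L_1L_2$. For $z\in\mathbb{C}$ let $S_z=\mathbb{C}^2/\Lambda_z$, where $\Lambda_z\subset\mathbb{C}^2$ is the $\mathbb{Z}$-span of the columns of \[\begin{pmatrix} \tau_{2} & 1 & z & 0\\ 0 & 0 & \tau_{1} & 1\end{pmatrix},\] so that $S_z$ is an extension $0\to E_2\to S_z\to E_1\to 0$ of complex tori. Suppose the image $P$ of $z$ in $\tilde E$ is a torsion point of order $n\ge1$. Then \[S_z \cong \mathbb{C}/\mathcal{O}_{nf} \oplus \tilde E/\langle P\rangle.\]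
   Context: $\mathcal{O}_m=\mathbb{Z}+m\mathcal{O}_K$; the conductor of a lattice $L\subset K$ is the $m$ with $\{\alpha\in K:\alpha L\subset L\}=\mathcal{O}_m$. $L_1L_2$ denotes the product lattice (the $\mathbb{Z}$-span of products). The map $z\mapsto S_z$ induces an isomorphism from $\tilde E$ onto the group of extension classes of $E_1$ by $E_2$ as complex tori. *)

(* Defs.v *)
From HB Require Import structures.
From mathcomp Require Import all_boot all_order all_algebra.
From mathcomp Require Import reals.
From mathcomp Require Import complex.
Set Implicit Arguments. Unset Strict Implicit. Unset Printing Implicit Defensive.
Import Order.TTheory GRing.Theory Num.Theory.
Local Open Scope ring_scope.

Section Defs.
Variable R : realType.
Local Notation C := R[i].

(* The imaginary quadratic field Q(delta) with delta^2 = -d, d > 0 (as a subset of C). *)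
Definition inQuadField (delta : C) (x : C) : Prop :=
  exists a b : rat, x = ratr a + ratr b * delta.

Definition alg_integer (x : C) : Prop :=
  exists p : {poly int}, p \is monic /\ root (map_poly (fun k : int => k%:~R) p) x.

Definition inOK (delta : C) (x : C) : Prop := inQuadField delta x /\ alg_integer x.

Definition inOrder (delta : C) (m : nat) (x : C) : Prop :=
  exists (a : int) (w : C), inOK delta w /\ x = a%:~R + m%:R * w.

Definition inLat (tau : C) (x : C) : Prop :=
  exists a b : int, x = a%:~R + b%:~R * tau.

Definition has_conductor (delta : C) (L : C -> Prop) (m : nat) : Prop :=
  (0 < m)%N /\
  forall alpha : C,
    (inQuadField delta alpha /\ (forall x, L x -> L (alpha * x))) <-> inOrder delta m alpha.

Definition inProdLat (L1 L2 : C -> Prop) (x : C) : Prop :=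
  exists s : seq (int * (C * C)),
    (forall t, t \in s -> L1 t.2.1 /\ L2 t.2.2) /\
    x = \sum_(t <- s) t.1%:~R * (t.2.1 * t.2.2).

Definition inLambda (tau1 tau2 z : C) (v : C * C) : Prop :=
  exists a b c d : int,
    v = (a%:~R * tau2 + b%:~R + c%:~R * z, c%:~R * tau1 + d%:~R).

(* the lattice L + Z z (so that (C/L)/<image of z> = C/(L + Z z)) *)
Definition inLatAdjoin (L : C -> Prop) (z : C) (x : C) : Prop :=
  exists (y : C) (k : int), L y /\ x = y + k%:~R * z.

Definition inSumLat (M1 M2 : C -> Prop) (v : C * C) : Prop := M1 v.1 /\ M2 v.2.

(* isomorphism of complex 2-tori C^2/L ~ C^2/L' : an invertible C-linear map
   of C^2 carrying L onto L' *)
Definition torus2_iso (L L' : C * C -> Prop) : Prop :=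
  exists a b c d : C, a * d - b * c != 0 /\
    forall v : C * C, L v <-> L' (a * v.1 + b * v.2, c * v.1 + d * v.2).

Definition torsion_order (L : C -> Prop) (z : C) (n : nat) : Prop :=
  (0 < n)%N /\ L (n%:R * z) /\ forall k : nat, (0 < k < n)%N -> ~ L (k%:R * z).

End Defs.

(* Main.v *)
(* The lattice Lambda_z is a module over O = O_{nf} = Z[T].  Suppose that a linear
   functional phi on C^2 maps Lambda_z onto O, say phi v = 1 with v in Lambda_z.
   Then u |-> (phi u, det(v, u)) maps Lambda_z onto the direct sum of O and M, the Z-span
   of all det(u, u') with u, u' in Lambda_z; on the given basis of Lambda_z these
   determinants are 1, tau1, tau2, tau1 tau2, z and 0, so M = L1 L2 + Z z.

   Such a phi corresponds to an integral functional l on Lambda_z = Z^4 with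
   l(v) = 0 and l(Tv) = 1, by phi u = l(Tu) - conj(T) l(u).  It exists as soon as
   v and Tv generate a primitive sublattice, i.e. v is an eigenvector of T modulo
   no prime.  Now T is scalar modulo no prime: for primes not dividing n this
   holds because f/f1 and f/f2 are coprime, and for primes dividing n because P
   has order exactly n.  As T preserves L2 + 0, the vector v can be found by
   applying the Chinese remainder theorem twice: to its image in L1 first, then
   to its component in L2. *)

Require Import Defs.
From HB Require Import structures.
From mathcomp Require Import all_boot all_order all_algebra all_field.
From mathcomp Require Import reals.
From mathcomp Require Import complex.
From mathcomp Require Import ring zify.
Set Implicit Arguments. Unset Strict Implicit. Unset Printing Implicit Defensive.
Import Order.TTheory GRing.Theory Num.Theory.
Local Open Scope ring_scope.

(** * Divisibility and the Chinese remainder theorem *)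

Lemma prime_dvdzM (p : nat) (x y : int) : prime p ->
  (p %| x * y)%Z = (p %| x)%Z || (p %| y)%Z.
Proof. by move=> pp; rewrite !dvdzE abszM Euclid_dvdM. Qed.

Lemma prime_not_dvdz1 (p : nat) : prime p -> (p %| 1)%Z = false.
Proof. by move=> pp; rewrite dvdzE Euclid_dvd1. Qed.

Lemma dvdz_comb (d x t : int) (u : int) :
  (d %| x)%Z -> t = u * x -> (d %| t)%Z.
Proof. by move=> dx ->; rewrite dvdz_mull. Qed.
Arguments dvdz_comb [d x t] u _ _.

Lemma dvdz_comb2 (d x y t : int) (u v : int) :
  (d %| x)%Z -> (d %| y)%Z -> t = u * x + v * y -> (d %| t)%Z.
Proof. by move=> dx dy ->; rewrite rpredD ?dvdz_mull. Qed.
Arguments dvdz_comb2 [d x y t] u v _ _ _.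

Lemma dvdz_comb3 (d x y z t : int) (u v w : int) :
  (d %| x)%Z -> (d %| y)%Z -> (d %| z)%Z -> t = u * x + v * y + w * z ->
  (d %| t)%Z.
Proof. by move=> dx dy dz ->; rewrite !rpredD ?dvdz_mull. Qed.
Arguments dvdz_comb3 [d x y z t] u v w _ _ _ _.

Lemma dvdz_det_addM (l a b t u a' b' t' u' : int) :
  (l %| (a + a' * l) * (t + t' * l) - (b + b' * l) * (u + u' * l))%Z
    = (l %| a * t - b * u)%Z.
Proof.
set k := (X in (_ %| X)%Z).
have -> : k = a * t - b * u + (a * t' + a' * t + a' * t' * l
    - b * u' - b' * u - b' * u' * l) * l by rewrite /k; ring.
by rewrite rpredDr // dvdz_mull.
Qed.

(** The second hypothesis makes [P p] a condition on residues modulo [p]. The induction glues in one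
    more prime by a Bezout relation. *)
Lemma zmod_crt (V : zmodType) (P : nat -> V -> Prop) (s : seq nat) :
  all prime s ->
  (forall p v w, P p v -> P p (v + w *+ p)) ->
  {in s, forall p, exists v, P p v} ->
  exists v, {in s, forall p, P p v}.
Proof.
move=> + Pinv; elim: s => [|p s IHs] /=; first by exists 0.
case/andP=> pp ps exP.
have [|v Pv] := IHs ps.
  by move=> q qs; apply: exP; rewrite inE qs orbT.
have [p_s|p_s] := boolP (p \in s).
  by exists v => q; rewrite inE => /orP[/eqP->|]; apply: Pv.
have [vp Pvp] := exP p (mem_head _ _).
pose M := (\prod_(q <- s) q)%N.
have M_gt0 : (0 < M)%N.
  by rewrite /M big_seq prodn_cond_gt0 // => q qs; rewrite prime_gt0 // (allP ps).
have coMp : coprime M p.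
  rewrite coprime_sym prime_coprime // Euclid_dvd_prod //.
  rewrite big_has; apply/hasPn => q qs /=.
  rewrite dvdn_prime2 //; last exact: (allP ps).
  by apply: contra p_s => /eqP->.
have [u k + _] := egcdnP p M_gt0; rewrite (eqP coMp) => def_u.
(* Since [u * M = k * p + 1] and every [q] in [s] divides [M], this is [vp] modulo [p] and [v]
   modulo [q]. *)
exists (v + (vp - v) *+ (u * M)) => q; rewrite inE => /orP[/eqP->|qs].
  have -> : v + (vp - v) *+ (u * M) = vp + ((vp - v) *+ k) *+ p.
    by rewrite def_u addn1 mulrSr -mulrnA addrCA [v + _]addrC subrK addrC.
  exact: Pinv.
have /dvdnP[m ->] : (q %| u * M)%N.
  by rewrite dvdn_mull // /M (big_rem q) //= dvdn_mulr.
by rewrite mulrnA; apply: Pinv; apply: Pv.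
Qed.

Lemma bezout6 (x1 x2 x3 x4 x5 x6 : int) :
  (forall p : nat, prime p ->
     ~~ [&& (p %| x1)%Z, (p %| x2)%Z, (p %| x3)%Z, (p %| x4)%Z, (p %| x5)%Z
          & (p %| x6)%Z]) ->
  exists u1 u2 u3 u4 u5 u6 : int,
    u1 * x1 + u2 * x2 + u3 * x3 + u4 * x4 + u5 * x5 + u6 * x6 = 1.
Proof.
move=> cop.
have [u5 [v5 e5]] := Bezoutz x5 x6.
have [u4 [v4 e4]] := Bezoutz x4 (gcdz x5 x6).
have [u3 [v3 e3]] := Bezoutz x3 (gcdz x4 (gcdz x5 x6)).
have [u2 [v2 e2]] := Bezoutz x2 (gcdz x3 (gcdz x4 (gcdz x5 x6))).
have [u1 [v1 e1]] := Bezoutz x1 (gcdz x2 (gcdz x3 (gcdz x4 (gcdz x5 x6)))).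
set G := gcdz x1 _ in e1.
suff G1 : G = 1.
  exists u1, (v1 * u2), (v1 * v2 * u3), (v1 * v2 * v3 * u4),
    (v1 * v2 * v3 * v4 * u5), (v1 * v2 * v3 * v4 * v5).
  by rewrite -G1 -e1 -e2 -e3 -e4 -e5; ring.
have G0 : G = `|G|%N by rewrite /G /gcdz.
apply/eqP; rewrite G0 eqz_nat; apply: contraT => G_neq1.
suff [p pp pG] : exists2 p, prime p & (p %| `|G|)%N.
  have := cop p pp; rewrite -!dvdz_gcd.
  by rewrite -/G dvdzE /= pG.
case: (ltngtP 1%N `|G|%N) G_neq1 => // [G_gt1|+] _.
  by have [p] := pdivP G_gt1; exists p.
(* The remaining gcd is 0, which every prime divides. *)
by rewrite ltnS leqn0 => /eqP->; exists 2%N.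
Qed.

(** * A vector that is an eigenvector modulo no prime *)

Section CyclicVector.

Variables n g1 g2 a1 b1 c1 a2 b2 c2 e p q r s : int.

(* Coordinates of the image of x.1 e1 + x.2 e2 + y.1 e3 + y.2 e4 under the
   multiplication by n g1 a1 tau1 of the lattice Lambda_z, in its basis
   e1 = (tau2, 0), e2 = (1, 0), e3 = (z, tau1), e4 = (0, 1). *)
Definition mulT1 (x y : int * int) : int :=
  n * (e - g2 * b2) * x.1 + n * g2 * a2 * x.2 + s * y.1 - q * y.2.
Definition mulT2 (x y : int * int) : int :=
  - (n * g2 * c2) * x.1 + n * e * x.2 + r * y.1 - p * y.2.
Definition mulT3 (y : int * int) : int := n * g1 * a1 * y.2 - n * g1 * b1 * y.1.
Definition mulT4 (y : int * int) : int := - (n * g1 * c1) * y.1.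

(** The six 2 by 2 minors of [v = (x, y)] and [T v]: [l] divides them all exactly when [v] and [T v]
    are linearly dependent modulo [l]. *)
Definition eigen_mod (l : nat) (x y : int * int) : bool :=
  [&& (l %| x.1 * mulT2 x y - x.2 * mulT1 x y)%Z,
      (l %| x.1 * mulT3 y - y.1 * mulT1 x y)%Z,
      (l %| x.1 * mulT4 y - y.2 * mulT1 x y)%Z,
      (l %| x.2 * mulT3 y - y.1 * mulT2 x y)%Z,
      (l %| x.2 * mulT4 y - y.2 * mulT2 x y)%Z
    & (l %| y.1 * mulT4 y - y.2 * mulT3 y)%Z].

Lemma eigen_modD (l : nat) (x y x' y' : int * int) :
  eigen_mod l (x + x' *+ l) (y + y' *+ l) = eigen_mod l x y.
Proof.
have fstE (u v : int * int) : (u + v *+ l).1 = u.1 + v.1 * l%:Z.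
  by rewrite -[LHS]/(u.1 + (v *+ l).1) (raddfMn fst) -mulr_natr natz.
have sndE (u v : int * int) : (u + v *+ l).2 = u.2 + v.2 * l%:Z.
  by rewrite -[LHS]/(u.2 + (v *+ l).2) (raddfMn snd) -mulr_natr natz.
have T1 : mulT1 (x + x' *+ l) (y + y' *+ l) = mulT1 x y + mulT1 x' y' * l%:Z.
  by rewrite /mulT1 !fstE !sndE; ring.
have T2 : mulT2 (x + x' *+ l) (y + y' *+ l) = mulT2 x y + mulT2 x' y' * l%:Z.
  by rewrite /mulT2 !fstE !sndE; ring.
have T3 : mulT3 (y + y' *+ l) = mulT3 y + mulT3 y' * l%:Z.
  by rewrite /mulT3 !fstE !sndE; ring.
have T4 : mulT4 (y + y' *+ l) = mulT4 y + mulT4 y' * l%:Z.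
  by rewrite /mulT4 !fstE; ring.
by rewrite /eigen_mod T1 T2 T3 T4 !fstE !sndE !dvdz_det_addM.
Qed.

Hypothesis cop1 : exists u v w : int, u * a1 + v * b1 + w * c1 = 1.
Hypothesis cop2 : exists u v w : int, u * a2 + v * b2 + w * c2 = 1.
Hypothesis copg : exists u v : int, u * g1 + v * g2 = 1.
Hypothesis copn : forall l : nat, prime l -> (l %| n)%Z ->
  ~~ [&& (l %| p)%Z, (l %| q)%Z, (l %| r)%Z & (l %| s)%Z].

(** The test vectors are e3, e4 and e3 + e4. If [l] divides [n], minors of e3 and e4 are [p], [q],
    [r], [s] up to sign, against [copn]. Otherwise [l] divides [g2], hence not [g1], and the last
    minors give [n g1] times [a1], [b1], [c1], against [cop1]. *)
Lemma exists_not_eigen_mod (l : nat) : prime l -> (l %| n * g2)%Z ->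
  exists x y, ~~ eigen_mod l x y.
Proof.
move=> pl; rewrite prime_dvdzM // => dvd_ng2.
have [|] := boolP (eigen_mod l (0, 0) (1, 0)); last by exists (0, 0), (1, 0).
have [|] := boolP (eigen_mod l (0, 0) (0, 1)); last by exists (0, 0), (0, 1).
have [|] := boolP (eigen_mod l (0, 0) (1, 1)); last by exists (0, 0), (1, 1).
rewrite /eigen_mod /mulT1 /mulT2 /mulT3 /mulT4 /=.
case/and5P=> _ _ _ _ /andP[_ d11].
case/and5P=> _ _ d3 _ /andP[d5 d01].
case/and5P=> _ d2 _ d4 /andP[_ d10].
have [dn|ndn] := boolP (l %| n)%Z.
  suff : [&& (l %| p)%Z, (l %| q)%Z, (l %| r)%Z & (l %| s)%Z].
    by rewrite (negPf (copn pl dn)).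
  apply/and4P; split.
  - by apply: (dvdz_comb 1 d5); ring.
  - by apply: (dvdz_comb 1 d3); ring.
  - by apply: (dvdz_comb (-1) d4); ring.
  - by apply: (dvdz_comb (-1) d2); ring.
have ndg1 : ~~ (l %| g1)%Z.
  rewrite (negPf ndn) /= in dvd_ng2.
  have [u [v uv]] := copg; apply: contraFN (prime_not_dvdz1 pl) => dg1.
  exact: (dvdz_comb2 u v dg1 dvd_ng2 (esym uv)).
have [u [v [w uvw]]] := cop1.
suff : (l %| n * g1)%Z by rewrite prime_dvdzM // (negPf ndn) (negPf ndg1).
apply: (dvdz_comb3 (- (u + v)) (- (w + v)) v d01 d10 d11).
by rewrite -[LHS]mulr1 -[X in _ * X = _]uvw; ring.
Qed.

(** On L2, [T] acts as [n g2 a2 tau2] plus an integer, which is not scalar modulo [l] by [cop2].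
    Dependence at the four test points over [y] forces [y = 0] modulo [l], and then [T] scalar on
    L2. *)
Lemma exists_not_eigen_mod_fiber (l : nat) (y : int * int) :
  prime l -> ~~ (l %| n * g2)%Z -> exists x, ~~ eigen_mod l x y.
Proof.
move=> pl nd; have [u [v [w uvw]]] := cop2.
have [|] := boolP (eigen_mod l (0, 0) y); last by exists (0, 0).
have [|] := boolP (eigen_mod l (1, 0) y); last by exists (1, 0).
have [|] := boolP (eigen_mod l (0, 1) y); last by exists (0, 1).
have [|] := boolP (eigen_mod l (1, 1) y); last by exists (1, 1).
case: y => y1 y2; rewrite /eigen_mod /mulT1 /mulT2 /mulT3 /mulT4 /=.
move=> /and5P[k1 _ _ _ _] /and5P[i1 i2 i3 i4 /andP[i5 _]].
move=> /and5P[j1 j2 j3 j4 /andP[j5 _]] /and5P[_ h2 h3 h4 /andP[h5 _]].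
have triple t : (l %| n * g2 * a2 * t)%Z -> (l %| n * g2 * b2 * t)%Z ->
    (l %| n * g2 * c2 * t)%Z -> (l %| t)%Z.
  move=> da db dc.
  suff : (l %| n * g2 * t)%Z by rewrite prime_dvdzM // (negPf nd).
  apply: (dvdz_comb3 u v w da db dc).
  by rewrite -[LHS]mulr1 -[X in _ * X = _]uvw; ring.
(* Differences with the minors at [x = (0, 0)] isolate [n g2 y1] times [a2], [b2] and [c2]. *)
have dy1 : (l %| y1)%Z.
  apply: triple.
  - by apply: (dvdz_comb2 1 (-1) h2 i2); ring.
  - by apply: (dvdz_comb3 1 (-1) (1) j2 i4 (rpredB h4 h2)); ring.
  - by apply: (dvdz_comb2 (-1) 1 h4 j4); ring.
have dy2 : (l %| y2)%Z.
  apply: triple.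
  - by apply: (dvdz_comb2 1 (-1) h3 i3); ring.
  - by apply: (dvdz_comb3 1 (-1) (1) j3 i5 (rpredB h5 h3)); ring.
  - by apply: (dvdz_comb2 (-1) 1 h5 j5); ring.
suff : (l %| 1)%Z by rewrite prime_not_dvdz1.
apply: triple; rewrite mulr1.
- by apply: (dvdz_comb3 (-1) (- s) q i1 dy1 dy2); ring.
- by apply: (dvdz_comb3 1 (-1) (-1) k1 i1 j1); ring.
- by apply: (dvdz_comb3 (-1) r (- p) j1 dy1 dy2); ring.
Qed.

Hypothesis n0 : n != 0.
Hypothesis g10 : g1 != 0.
Hypothesis g20 : g2 != 0.
Hypothesis anisotropic1 : forall y1 y2 : int,
  c1 * y1 ^+ 2 - b1 * y1 * y2 + a1 * y2 ^+ 2 = 0 -> y1 = 0 /\ y2 = 0.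

Lemma cyclic_vector : exists x y l m : int * int,
  l.1 * x.1 + l.2 * x.2 + m.1 * y.1 + m.2 * y.2 = 0 /\
  l.1 * mulT1 x y + l.2 * mulT2 x y + m.1 * mulT3 y + m.2 * mulT4 y = 1.
Proof.
have [y [y_neq0 Py]] : exists y : int * int, y != 0 /\
    forall l : nat, prime l -> exists x, ~~ eigen_mod l x y.
  pose P (l : nat) (y : int * int) := exists x, ~~ eigen_mod l x y.
  have PD l v w : P l v -> P l (v + w *+ l).
    by case=> x ngx; exists x; rewrite -[x]addr0 -(mul0rn _ l) eigen_modD.
  have [||y Py] := @zmod_crt (int * int)%type P (primes `|n * g2|) _ PD.
  - by apply/allP=> l; rewrite mem_primes => /and3P[].
  - move=> l; rewrite mem_primes => /and3P[pl _ dl].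
    by have [x [y nxy]] := exists_not_eigen_mod pl dl; exists y, x.
  (* The congruences may be solved by 0; [(n * g2, 0)] has the same residues modulo the primes
     concerned and is nonzero. *)
  pose y' := if y == 0 then (n * g2, 0) : int * int else y.
  exists y'; split.
    rewrite /y'; have [_|//] := eqVneq y 0.
    by apply/eqP => -[/eqP]; rewrite mulf_eq0 (negPf n0) (negPf g20).
  move=> l pl; have [dl|] := boolP (l %| n * g2)%Z; last first.
    exact: exists_not_eigen_mod_fiber.
  have {}Py : P l y by apply: Py; rewrite mem_primes pl absz_gt0 mulf_neq0.
  rewrite /y'; have [y0|//] := eqVneq y 0.
  have /dvdzP[k ->] := dl.
  suff -> : (k * l, 0) = y + (k, 0) *+ l by apply: PD.
  rewrite y0 add0r [RHS]surjective_pairing (raddfMn fst) (raddfMn snd) /=.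
  by rewrite mul0rn -mulr_natr natz.
(* This minor is [- n g1] times a norm form of L1 at [y]. It does not involve [x], so only its prime
   divisors constrain the choice of [x]. *)
have det_neq0 : y.1 * mulT4 y - y.2 * mulT3 y != 0.
  apply: contra y_neq0 => /eqP det0.
  suff /anisotropic1[y10 y20] :
      c1 * y.1 ^+ 2 - b1 * y.1 * y.2 + a1 * y.2 ^+ 2 = 0.
    by apply/eqP; rewrite [y]surjective_pairing y10 y20.
  have ng10 : - (n * g1) != 0 by rewrite oppr_eq0 mulf_neq0.
  by apply: (mulfI ng10); rewrite mulr0 -det0 /mulT3 /mulT4; ring.
have [x ngx] : exists x, forall l : nat, prime l -> ~~ eigen_mod l x y.
  pose P (l : nat) (x : int * int) := ~~ eigen_mod l x y.
  pose N := absz (y.1 * mulT4 y - y.2 * mulT3 y)%R.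
  have [|||x Px] := @zmod_crt (int * int)%type P (primes N).
  - by apply/allP=> l; rewrite mem_primes => /and3P[].
  - by move=> l v w; rewrite /P -(eigen_modD l v y w 0) mul0rn addr0.
  - by move=> l; rewrite mem_primes => /and3P[/Py].
  exists x => l pl; have [lN|lN] := boolP (l \in primes N); first exact: Px.
  apply: contra lN => /and5P[_ _ _ _ /andP[_ dl]].
  by rewrite mem_primes pl absz_gt0 det_neq0.
have [m12 [m13 [m14 [m23 [m24 [m34 m_eq1]]]]]] := bezout6 ngx.
(* The functional u |-> sum_(i < j) m_ij (v_i u_j - v_j u_i), with v = (x, y). *)
exists x, y, (- (m12 * x.2 + m13 * y.1 + m14 * y.2),
  m12 * x.1 - m23 * y.1 - m24 * y.2),
  (m13 * x.1 + m23 * x.2 - m34 * y.2, m14 * x.1 + m24 * x.2 + m34 * y.1).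
by split; rewrite /= -?m_eq1; ring.
Qed.

End CyclicVector.

(** * Quadratic lattices and their multiplier rings *)

(** Serves to prove identities modulo relations: each use subtracts [k] times a known equation,
    until [ring] can conclude. *)
Lemma eq_comb (A : pzRingType) (x y u v k : A) :
  u = v -> x - k * (u - v) = y -> x = y.
Proof. by move=> ->; rewrite subrr mulr0 subr0. Qed.
Arguments eq_comb [A x y u v] k _ _.

Lemma nonreal_indep (F : numFieldType) (tau : F) (a b : int) :
  tau \isn't Num.real -> a%:~R + b%:~R * tau = 0 -> a = 0 /\ b = 0.
Proof.
move=> ntau; have [->|b0] := eqVneq b 0.
  by rewrite mul0r addr0 => /eqP; rewrite intr_eq0 => /eqP.
move=> ab0; suff : tau \is Num.real by rewrite (negPf ntau).
have bF : b%:~R != 0 :> F by rewrite intr_eq0.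
have -> : tau = - a%:~R / b%:~R.
  apply: (mulfI bF); rewrite mulrCA mulfV // mulr1.
  by apply/eqP; rewrite -addr_eq0 addrC ab0.
by rewrite rpredM ?rpredV ?rpredN ?realz.
Qed.

Lemma int3_primitive (a0 b0 c0 : int) : a0 != 0 ->
  exists g a b c : int, [/\ a0 = g * a, b0 = g * b, c0 = g * c, g != 0 &
    exists u v w : int, u * a + v * b + w * c = 1].
Proof.
move=> a0_neq0; pose g := gcdz a0 (gcdz b0 c0).
have g0 : g != 0 by rewrite gcdz_eq0 negb_and a0_neq0.
have /dvdzP[a ea] : (g %| a0)%Z by rewrite dvdz_gcdl.
have /dvdzP[b eb] : (g %| b0)%Z.
  by rewrite (dvdz_trans (dvdz_gcdr _ _)) // dvdz_gcdl.
have /dvdzP[c ec] : (g %| c0)%Z.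
  by rewrite (dvdz_trans (dvdz_gcdr _ _)) // dvdz_gcdr.
exists g, a, b, c; split; rewrite ?[g * _]mulrC //.
have [v [w vw]] := Bezoutz b0 c0.
have [u [t ut]] := Bezoutz a0 (gcdz b0 c0).
exists u, (t * v), (t * w); apply: (mulfI g0).
by rewrite mulr1 -[RHS]ut -vw [in RHS]ea [in RHS]eb [in RHS]ec; ring.
Qed.

Section QuadraticField.

Variables (R : realType) (d : nat) (delta : R[i]).
Hypothesis delta2 : delta ^+ 2 = - d%:R.

Lemma inQuadField_int (k : int) : inQuadField delta k%:~R.
Proof. by exists k%:~R, 0; rewrite rmorph0 mul0r addr0 rmorph_int. Qed.

Lemma inQuadField_comb (k m : int) (x y : R[i]) :
  inQuadField delta x -> inQuadField delta y ->
  inQuadField delta (k%:~R * x + m%:~R * y).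
Proof.
move=> [u [v ->]] [u' [v' ->]].
exists (k%:~R * u + m%:~R * u'), (k%:~R * v + m%:~R * v').
by rewrite !rmorphD !rmorphM !rmorph_int; ring.
Qed.

Lemma inQuadField_primitive_eq (tau : R[i]) : inQuadField delta tau ->
  exists a b c : int,
    [/\ a != 0, exists u v w : int, u * a + v * b + w * c = 1
      & a%:~R * tau ^+ 2 + b%:~R * tau + c%:~R = 0].
Proof.
move=> [u [v tauE]].
(* Minus the trace and the norm of [tau = u + v delta]. *)
pose be := - (u *+ 2); pose ga := u ^+ 2 + v ^+ 2 * d%:R.
have tau2 : tau ^+ 2 + ratr be * tau + ratr ga = 0.
  rewrite tauE /be /ga rmorphN rmorphMn rmorphD rmorphXn rmorphM rmorphXn /=.
  by rewrite ratr_nat; apply: (eq_comb (ratr v ^+ 2) delta2); ring.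
have rE (x : rat) : (denq x)%:~R * ratr x = (numq x)%:~R :> R[i].
  rewrite -[in ratr _](divq_num_den x) fmorph_div /= !ratr_int.
  by rewrite mulrCA mulfV ?mulr1 // intr_eq0 denq_neq0.
have [|g [a [b [c [ea eb ec g0 cop]]]]] := @int3_primitive
  (denq be * denq ga) (numq be * denq ga) (numq ga * denq be).
  by rewrite mulf_neq0 ?denq_neq0.
exists a, b, c; split=> //.
  apply: contraTneq (isT : true) => a0; move/eqP: ea.
  by rewrite a0 mulr0 mulf_eq0 !(negPf (denq_neq0 _)).
have gF : g%:~R != 0 :> R[i] by rewrite intr_eq0.
apply: (mulfI gF); rewrite mulr0 !mulrDr !mulrA -!intrM -ea -eb -ec !intrM -!rE.
by rewrite -[RHS](mulr0 ((denq be)%:~R * (denq ga)%:~R)) -tau2; ring.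
Qed.

(** If [alpha = i + k tau], comparing coefficients in [a alpha tau] shows that [a] divides [k b] and
    [k c], hence [k] by primitivity. *)
Lemma inLat_multiplier (tau alpha : R[i]) (a b c : int) :
  tau \isn't Num.real -> a != 0 ->
  (exists u v w : int, u * a + v * b + w * c = 1) ->
  a%:~R * tau ^+ 2 + b%:~R * tau + c%:~R = 0 ->
  (forall x, inLat tau x -> inLat tau (alpha * x)) <->
  exists i j : int, alpha = i%:~R + j%:~R * (a%:~R * tau).
Proof.
move=> ntau a0 [u [v [w uvw]]] eq_tau; split=> [stab|[i [j ->]] _ [k [m ->]]].
  have [|i [k alphaE]] := stab 1; first by exists 1, 0; rewrite mul0r addr0.
  have [|i' [j' tauE]] := stab tau; first by exists 0, 1; rewrite mul1r add0r.
  rewrite mulr1 in alphaE.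
  have [e1 e2] : k * c + a * i' = 0 /\ k * b + a * j' - a * i = 0.
    apply: (nonreal_indep ntau); rewrite !(intrD, intrM, intrN).
    apply: (eq_comb (- a%:~R) tauE); apply: (eq_comb k%:~R eq_tau).
    by apply: (eq_comb (a%:~R * tau) alphaE); ring.
  have da : (a %| a)%Z by [].
  have /dvdzP[j kE] : (a %| k)%Z.
    apply: (dvdz_comb (u * k - v * j' + v * i - w * i') da).
    apply: (eq_comb (- k) uvw); apply: (eq_comb v e2).
    by apply: (eq_comb w e1); ring.
  by exists i, j; rewrite alphaE kE intrM; ring.
exists (i * k - j * m * c), (i * m + j * k * a - j * m * b).
rewrite !(intrD, intrM, intrN).
by apply: (eq_comb (j%:~R * m%:~R) eq_tau); ring.
Qed.

(** A rational algebraic integer is an integer; the polynomial is moved to [algC] to apply this. *)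
Lemma alg_integer_rational (m : nat) (x : R[i]) (i : int) : (0 < m)%N ->
  alg_integer x -> m%:R * x = i%:~R -> exists k : int, x = k%:~R.
Proof.
move=> m_gt0 [p [mp px]] mx.
have xE : x = ratr (i%:~R / m%:R).
  rewrite fmorph_div /= ratr_int ratr_nat -mx mulrAC mulfV ?mul1r //.
  by rewrite pnatr_eq0 -lt0n.
set t := (i%:~R / m%:R : rat) in xE.
have pt : root (map_poly intr p) t.
  move: px; rewrite xE -(fmorph_root (@ratr R[i])) -map_poly_comp.
  by congr (root _ _); apply: eq_map_poly => k /=; rewrite ratr_int.
have Cp : root (map_poly intr p) (ratr t : algC).
  move: pt; rewrite -(fmorph_root (@ratr algC)) -map_poly_comp.
  by congr (root _ _); apply: eq_map_poly => k /=; rewrite ratr_int.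
have : (ratr t : algC) \is a Num.int.
  apply: Cint_rat_Aint; first exact: Crat_rat.
  apply: (root_monic_Aint Cp); first exact: monic_map.
  by apply/polyOverP => k; rewrite coef_map /= intr_int.
case/intrP=> k tE; exists k; rewrite xE.
suff -> : t = k%:~R by rewrite ratr_int.
by apply: (fmorph_inj (@ratr algC)); rewrite [LHS]tE; apply/esym/ratr_int.
Qed.

Lemma inOK_comb (i j : int) (x y : R[i]) :
  inOK delta x -> inOK delta y -> inOK delta (i%:~R * x + j%:~R * y).
Proof.
move=> [Kx [p [mp px]]] [Ky [q [mq qy]]]; split; first exact: inQuadField_comb.
have Ix : integralOver intr x by exists p.
have Iy : integralOver intr y by exists q.
have [r mr rz] : integralOver intr (i%:~R * x + j%:~R * y).
  by apply: integral_add; apply: integral_mul => //; apply: integral_id.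
by exists r.
Qed.

Lemma inOK1 : inOK delta 1.
Proof.
split; first exact: inQuadField_int 1.
have [p mp p1] := integral1 (intr : {rmorphism int -> R[i]}).
by exists p.
Qed.

(** The multiplier ring Z[a tau] is O_f, whence [w]. For [x] in O_K, writing [f x = i + j a tau]
    makes [x - j w] rational and integral, so 1 and [w] span O_K. *)
Lemma conductor_basis (tau : R[i]) (f : nat) :
  inQuadField delta tau -> tau \isn't Num.real ->
  has_conductor delta (inLat tau) f ->
  exists (a b c k : int) (w : R[i]),
    [/\ a != 0, exists u v w : int, u * a + v * b + w * c = 1,
        a%:~R * tau ^+ 2 + b%:~R * tau + c%:~R = 0,
        a%:~R * tau = k%:~R + f%:R * w &
        forall x, inOK delta x <-> exists i j : int, x = i%:~R + j%:~R * w].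
Proof.
move=> Ktau ntau [f_gt0 condf].
have [a [b [c [a0 cop eq_tau]]]] := inQuadField_primitive_eq Ktau.
have mulP alpha := inLat_multiplier alpha ntau a0 cop eq_tau.
have [|k [w [OKw atE]]] := (condf (a%:~R * tau)).1.
  split; first by rewrite -[_ * _]addr0 -(mulr0 0%:~R);
    apply: inQuadField_comb => //; apply: (inQuadField_int 0).
  by apply/mulP; exists 0, 1; rewrite add0r mul1r.
exists a, b, c, k, w; split=> // x; split=> [OKx|[i [j ->]]]; last first.
  by rewrite -[i%:~R]mulr1; apply: inOK_comb => //; apply: inOK1.
have /condf[_ /mulP[i [j fxE]]] : inOrder delta f (f%:R * x).
  by exists 0, x; rewrite add0r.
have [||m xE] := @alg_integer_rational f (x - j%:~R * w) (i + j * k) f_gt0.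
- have -> : x - j%:~R * w = 1%:~R * x + (- j)%:~R * w by rewrite intrN; ring.
  by have [] := inOK_comb 1 (- j) OKx OKw.
- by rewrite mulrBr fxE atE intrD intrM; ring.
by exists m, j; rewrite -xE; ring.
Qed.

End QuadraticField.

(** The generators [w1] and [w2] found for the two lattices agree up to sign and an integer. A wrong
    sign is absorbed by negating [a2], [b2], [c2]. *)
Lemma common_basis (R : realType) (d : nat) (delta tau1 tau2 : R[i])
    (f1 f2 : nat) :
  delta ^+ 2 = - d%:R ->
  inQuadField delta tau1 -> inQuadField delta tau2 ->
  tau1 \isn't Num.real -> tau2 \isn't Num.real ->
  has_conductor delta (inLat tau1) f1 -> has_conductor delta (inLat tau2) f2 ->
  exists (w : R[i]) (a1 b1 c1 k1 a2 b2 c2 k2 : int),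
    [/\ forall x, inOK delta x <-> exists i j : int, x = i%:~R + j%:~R * w,
        [/\ a1 != 0, exists u v w : int, u * a1 + v * b1 + w * c1 = 1,
          a1%:~R * tau1 ^+ 2 + b1%:~R * tau1 + c1%:~R = 0 &
          a1%:~R * tau1 = k1%:~R + f1%:R * w] &
        [/\ a2 != 0, exists u v w : int, u * a2 + v * b2 + w * c2 = 1,
          a2%:~R * tau2 ^+ 2 + b2%:~R * tau2 + c2%:~R = 0 &
          a2%:~R * tau2 = k2%:~R + f2%:R * w]].
Proof.
move=> delta2 K1 K2 nr1 nr2 cond1 cond2.
have [a1 [b1 [c1 [k1 [w1 [a10 cop1 eq1 w1E OK1]]]]]] :=
  conductor_basis delta2 K1 nr1 cond1.
have [a2 [b2 [c2 [k2 [w2 [a20 cop2 eq2 w2E OK2]]]]]] :=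
  conductor_basis delta2 K2 nr2 cond2.
have [i [j w21]] : exists i j : int, w2 = i%:~R + j%:~R * w1.
  by apply/OK1/OK2; exists 0, 1; rewrite add0r mul1r.
have [i' [j' w12]] : exists i j : int, w1 = i%:~R + j%:~R * w2.
  by apply/OK2/OK1; exists 0, 1; rewrite add0r mul1r.
have [_ /eqP] : (j' * j - 1) * k1 - f1%:Z * (i' + j' * i) = 0
    /\ (1 - j' * j) * a1 = 0.
  apply: (nonreal_indep nr1).
  apply: (eq_comb (1 - j'%:~R * j%:~R) w1E).
  apply: (eq_comb f1%:R w12); apply: (eq_comb (f1%:R * j'%:~R) w21).
  ring.
rewrite mulf_eq0 (negPf a10) orbF subr_eq0 eq_sym => /eqP jj1.
exists w1, a1, b1, c1, k1.
have [j1|j1] : j = 1 \/ j = -1.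
  have : (`|j'|%N * `|j|%N = 1)%N by rewrite -abszM jj1.
  by move/eqP; rewrite muln_eq1 => /andP[_ /eqP]; lia.
  exists a2, b2, c2, (k2 + f2%:Z * i); split=> //; split=> //.
  by rewrite w2E w21 j1; ring.
exists (- a2), (- b2), (- c2), (- k2 - f2%:Z * i); split=> //; split.
- by rewrite oppr_eq0.
- by have [u [v [w uvw]]] := cop2; exists (- u), (- v), (- w); rewrite -uvw; ring.
- by apply: (eq_comb (-1) eq2); ring.
- by apply: (eq_comb (-1) w2E); apply: (eq_comb (- f2%:R) w21); rewrite j1; ring.
Qed.

Lemma inProdLat_inLat (R : realType) (tau1 tau2 x : R[i]) :
  inProdLat (inLat tau1) (inLat tau2) x <->
  exists i j k l : int,
    x = i%:~R + j%:~R * tau1 + k%:~R * tau2 + l%:~R * (tau1 * tau2).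
Proof.
split=> [[s [sL ->]]|[i [j [k [l ->]]]]].
  elim: s sL => [_|[m [x1 x2]] s IHs sL].
    by exists 0, 0, 0, 0; rewrite big_nil; ring.
  have [|i [j [k [l sE]]]] := IHs.
    by move=> t ts; apply: sL; rewrite inE ts orbT.
  have [/= [a [b ->]] [a' [b' ->]]] := sL _ (mem_head _ _).
  exists (i + m * a * a'), (j + m * b * a'), (k + m * a * b'), (l + m * b * b').
  by rewrite big_cons sE /=; ring.
have L1 tau : inLat tau (1 : R[i]) by exists 1, 0; ring.
have Lt tau : inLat tau (tau : R[i]) by exists 0, 1; ring.
exists [:: (i, (1, 1)); (j, (tau1, 1)); (k, (1, tau2)); (l, (tau1, tau2))].
split=> [t|]; last by rewrite !big_cons big_nil /=; ring.
by rewrite !inE => /or4P[] /eqP->.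
Qed.

(** * The extension Lambda_z *)

Section Extension.

Variables (R : realType) (tau1 tau2 z : R[i]).
Variables (n : nat) (g1 g2 a1 b1 c1 a2 b2 c2 e : int).

Hypothesis eq1 : a1%:~R * tau1 ^+ 2 + b1%:~R * tau1 + c1%:~R = 0.
Hypothesis eq2 : a2%:~R * tau2 ^+ 2 + b2%:~R * tau2 + c2%:~R = 0.
Hypothesis eqe : (g1 * a1)%:~R * tau1 = (g2 * a2)%:~R * tau2 + e%:~R.

(** Equality of traces in [eqe], read off from the difference of the monic equations of
    [g1 a1 tau1]. *)
Lemma middle_coef_eq : tau1 \isn't Num.real -> g1 != 0 -> a1 != 0 ->
  g2 * b2 = g1 * b1 + 2 * e.
Proof.
move=> nr1 g10 a10.
have [_ /eqP] : e ^+ 2 - g2 * b2 * e + g2 ^+ 2 * a2 * c2 - g1 ^+ 2 * a1 * c1 = 0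
    /\ (g2 * b2 - g1 * b1 - 2 * e) * (g1 * a1) = 0.
  apply: (nonreal_indep nr1).
  apply: (eq_comb ((g2 ^+ 2 * a2)%:~R) eq2).
  apply: (eq_comb (- (g1 ^+ 2 * a1)%:~R) eq1).
  apply: (eq_comb ((g1 * a1)%:~R * tau1 - e%:~R + (g2 * a2)%:~R * tau2
    + (g2 * b2)%:~R) eqe).
  ring.
rewrite !mulf_eq0 (negPf g10) (negPf a10) !orbF.
by rewrite -addrA -opprD subr_eq0 => /eqP.
Qed.

Hypothesis eqb : g2 * b2 = g1 * b1 + 2 * e.

Let eqbC : (g2 * b2)%:~R = (g1 * b1 + 2 * e)%:~R :> R[i].
Proof. by rewrite eqb. Qed.

(** * Coordinates of n z and the order of P *)

Section Coordinates.

Variables i j k l : int.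
Hypothesis eqz : n%:R * z =
  i%:~R + j%:~R * tau1 + k%:~R * tau2 + l%:~R * (tau1 * tau2).

(* The same four integers are the coordinates in L2 of the products of n z with
   g1 a1 and g1 (a1 tau1 + b1), and the coordinates in L1 of its products with
   g2 a2 and g2 (a2 tau2 + b2) = g1 (a1 tau1 + b1) + e. *)
Definition ext_p : int := i * (g1 * a1) + j * e - l * (g2 * c2).
Definition ext_q : int := j * (g2 * a2) + k * (g1 * a1) - l * (e + g1 * b1).
Definition ext_r : int := i * (e + g1 * b1) - j * (g1 * c1) - k * (g2 * c2).
Definition ext_s : int := i * (g2 * a2) - k * e - l * (g1 * c1).

Lemma ext_pq : (g1 * a1)%:~R * (n%:R * z) = ext_p%:~R + ext_q%:~R * tau2.
Proof.
apply: (eq_comb (g1 * a1)%:~R eqz); rewrite /ext_p /ext_q.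
apply: (eq_comb (j%:~R + l%:~R * tau2) eqe).
apply: (eq_comb (- l%:~R * tau2) eqbC).
by apply: (eq_comb (l * g2)%:~R eq2); ring.
Qed.

Lemma ext_sq : (g2 * a2)%:~R * (n%:R * z) = ext_s%:~R + ext_q%:~R * tau1.
Proof.
apply: (eq_comb (g2 * a2)%:~R eqz); rewrite /ext_s /ext_q.
apply: (eq_comb (- (k%:~R + l%:~R * tau1)) eqe).
by apply: (eq_comb (l * g1)%:~R eq1); ring.
Qed.

Lemma ext_rs : ((g1 * a1)%:~R * tau1 + (g1 * b1)%:~R) * (n%:R * z)
  = ext_r%:~R + ext_s%:~R * tau2.
Proof.
apply: (eq_comb ((g1 * a1)%:~R * tau1 + (g1 * b1)%:~R) eqz).
rewrite /ext_r /ext_s; apply: (eq_comb (i%:~R + k%:~R * tau2) eqe).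
apply: (eq_comb (- k%:~R * tau2) eqbC).
apply: (eq_comb (k * g2)%:~R eq2).
by apply: (eq_comb (j%:~R * g1%:~R + l%:~R * g1%:~R * tau2) eq1); ring.
Qed.

Lemma ext_rp : ((g1 * a1)%:~R * tau1 + (g1 * b1 + e)%:~R) * (n%:R * z)
  = ext_r%:~R + ext_p%:~R * tau1.
Proof.
apply: (eq_comb ((g1 * a1)%:~R * tau1 + (g1 * b1 + e)%:~R) eqz).
rewrite /ext_r /ext_p; apply: (eq_comb ((k%:~R + l%:~R * tau1) * tau2) eqe).
apply: (eq_comb (- (k%:~R + l%:~R * tau1) * tau2) eqbC).
apply: (eq_comb ((k%:~R + l%:~R * tau1) * g2%:~R) eq2).
by apply: (eq_comb (j * g1)%:~R eq1); ring.
Qed.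

Hypothesis cop1 : exists u v w : int, u * a1 + v * b1 + w * c1 = 1.
Hypothesis cop2 : exists u v w : int, u * a2 + v * b2 + w * c2 = 1.
Hypothesis copg : exists u v : int, u * g1 + v * g2 = 1.
Hypothesis ordz : torsion_order (inProdLat (inLat tau1) (inLat tau2)) z n.

(* If t divides n, p, q, r and s, then g1 y and g2 y lie in L1 L2 for
   y = (n / t) z, hence so does y. *)
Lemma ext_primitive (t : nat) : prime t -> (t %| n%:Z)%Z ->
  ~~ [&& (t %| ext_p)%Z, (t %| ext_q)%Z, (t %| ext_r)%Z & (t %| ext_s)%Z].
Proof.
move=> pt; rewrite dvdzE => /= /dvdnP[n' nE].
have [n_gt0 [_ ord_min]] := ordz.
apply/negP => /and4P[/dvdzP[p pE] /dvdzP[q qE] /dvdzP[r rE] /dvdzP[s sE]].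
have t0 : t%:R != 0 :> R[i] by rewrite pnatr_eq0 -lt0n prime_gt0.
apply: (ord_min n'); first by have := prime_gt1 pt; nia.
set y := n'%:R * z.
have yE : n%:R * z = t%:R * y by rewrite nE natrM /y; ring.
have e1 : (g1 * a1)%:~R * y = p%:~R + q%:~R * tau2.
  by apply: (mulfI t0); rewrite mulrCA -yE ext_pq pE qE; ring.
have e2 : (g2 * a2)%:~R * y = s%:~R + q%:~R * tau1.
  by apply: (mulfI t0); rewrite mulrCA -yE ext_sq sE qE; ring.
have e3 : ((g1 * a1)%:~R * tau1 + (g1 * b1)%:~R) * y = r%:~R + s%:~R * tau2.
  by apply: (mulfI t0); rewrite mulrCA -yE ext_rs rE sE; ring.
have e4 : ((g1 * a1)%:~R * tau1 + (g1 * b1 + e)%:~R) * y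
    = r%:~R + p%:~R * tau1.
  by apply: (mulfI t0); rewrite mulrCA -yE ext_rp rE pE; ring.
have y1E : (g1 * b1)%:~R * y
    = r%:~R + s%:~R * tau2 - tau1 * (p%:~R + q%:~R * tau2).
  by rewrite -e1 -e3; ring.
have y2E : (g1 * c1)%:~R * y = - tau1 * (r%:~R + s%:~R * tau2).
  by rewrite -e3; apply: (eq_comb (g1%:~R * y) eq1); ring.
have y3E : (g2 * b2)%:~R * y
    = r%:~R + p%:~R * tau1 - tau2 * (s%:~R + q%:~R * tau1).
  by rewrite -e2 -e4; apply: (eq_comb y eqbC); apply: (eq_comb (- y) eqe); ring.
have y4E : (g2 * c2)%:~R * y = - tau2 * (r%:~R + p%:~R * tau1).
  rewrite -e4; apply: (eq_comb (g2%:~R * y) eq2).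
  apply: (eq_comb (- y * tau2) eqbC).
  by apply: (eq_comb (y * tau2) eqe); ring.
have [u1 [v1 [w1 uvw1]]] := cop1; have [u2 [v2 [w2 uvw2]]] := cop2.
have [m1 [m2 m12]] := copg.
apply/inProdLat_inLat.
(* Coordinates of [y] after multiplying it by the product form of 1 from the three Bezout relations
   and expanding the six products above. *)
exists (m1 * (u1 * p + v1 * r) + m2 * (u2 * s + v2 * r)),
  (m2 * (u2 * q + v2 * p) - m1 * (v1 * p + w1 * r)),
  (m1 * (u1 * q + v1 * s) - m2 * (v2 * s + w2 * r)),
  (- m1 * (v1 * q + w1 * s) - m2 * (v2 * q + w2 * p)).
have -> : y = m1%:~R * (u1%:~R * ((g1 * a1)%:~R * y)
      + v1%:~R * ((g1 * b1)%:~R * y) + w1%:~R * ((g1 * c1)%:~R * y))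
    + m2%:~R * (u2%:~R * ((g2 * a2)%:~R * y)
      + v2%:~R * ((g2 * b2)%:~R * y) + w2%:~R * ((g2 * c2)%:~R * y)).
  transitivity (((m1 * g1) * (u1 * a1 + v1 * b1 + w1 * c1)
    + (m2 * g2) * (u2 * a2 + v2 * b2 + w2 * c2))%:~R * y); last by ring.
  by rewrite uvw1 uvw2 !mulr1 m12 mul1r.
by rewrite e1 e2 y1E y2E y3E y4E; ring.
Qed.

End Coordinates.

(** * Splitting of the lattice by the functional phi *)

Section Splitting.

Variables p q r s : int.
Hypothesis eqpq : (g1 * a1)%:~R * (n%:R * z) = p%:~R + q%:~R * tau2.
Hypothesis eqsq : (g2 * a2)%:~R * (n%:R * z) = s%:~R + q%:~R * tau1.
Hypothesis eqrs : ((g1 * a1)%:~R * tau1 + (g1 * b1)%:~R) * (n%:R * z)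
  = r%:~R + s%:~R * tau2.
Hypothesis eqrp : ((g1 * a1)%:~R * tau1 + (g1 * b1 + e)%:~R) * (n%:R * z)
  = r%:~R + p%:~R * tau1.

Local Notation T := (n%:R * ((g1 * a1)%:~R * tau1)).
Local Notation Lam := (inLambda tau1 tau2 z).
Local Notation mul1 := (mulT1 n g2 a2 b2 e q s).
Local Notation mul2 := (mulT2 n g2 c2 e p r).
Local Notation mul3 := (mulT3 n g1 a1 b1).
Local Notation mul4 := (mulT4 n g1 c1).

Lemma inLambdaD (u v : R[i] * R[i]) :
  Lam u -> Lam v -> Lam (u.1 + v.1, u.2 + v.2).
Proof.
move=> [x1 [x2 [y1 [y2 ->]]]] [x1' [x2' [y1' [y2' ->]]]].
exists (x1 + x1'), (x2 + x2'), (y1 + y1'), (y2 + y2').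
by congr pair => /=; ring.
Qed.

Lemma inLambdaZ (m : int) (u : R[i] * R[i]) :
  Lam u -> Lam (m%:~R * u.1, m%:~R * u.2).
Proof.
move=> [x1 [x2 [y1 [y2 ->]]]]; exists (m * x1), (m * x2), (m * y1), (m * y2).
by congr pair => /=; ring.
Qed.

(** The image of e3 under [T] comes from [eqrs], and that of e4 from [eqpq]. *)
Lemma inLambdaT (u : R[i] * R[i]) : Lam u -> Lam (T * u.1, T * u.2).
Proof.
move=> [x1 [x2 [y1 [y2 ->]]]].
exists (mul1 (x1, x2) (y1, y2)), (mul2 (x1, x2) (y1, y2)), (mul3 (y1, y2)),
  (mul4 (y1, y2)).
rewrite /mulT1 /mulT2 /mulT3 /mulT4; congr pair => /=.
  apply: (eq_comb (n%:R * (x1%:~R * tau2 + x2%:~R)) eqe).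
  apply: (eq_comb (n%:R * (x1 * g2)%:~R) eq2).
  by apply: (eq_comb y1%:~R eqrs); apply: (eq_comb (- y2%:~R) eqpq); ring.
by apply: (eq_comb (n%:R * (g1 * y1)%:~R) eq1); ring.
Qed.

Variables x y l m : int * int.
Hypothesis l_v : l.1 * x.1 + l.2 * x.2 + m.1 * y.1 + m.2 * y.2 = 0.
Hypothesis l_Tv :
  l.1 * mul1 x y + l.2 * mul2 x y + m.1 * mul3 y + m.2 * mul4 y = 1.

(* If l is the integral functional with coordinates (l, m), then
   phi u = l (T u) - conj(T) l u is linear over Z[T]; here alpha = phi (1, 0)
   and beta = phi (0, 1). *)
Definition split_alpha : R[i] :=
  (n%:Z * (g2 * a2 * l.1 + (e + g1 * b1) * l.2))%:~R + l.2%:~R * T.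
Definition split_beta : R[i] :=
  (n%:Z * g1 * (a1 * m.1 + b1 * m.2) - p * l.2 - q * l.1)%:~R + m.2%:~R * T.

Local Notation alpha := split_alpha.
Local Notation beta := split_beta.

(** The value at e1 of the C-linear map given by [alpha] and [beta] agrees with
    [l(T e1) - conj(T) l(e1)]; [split_alpha_z] is the same check at e3. *)
Lemma split_alpha_tau2 : alpha * tau2 =
  (n%:Z * ((e - g2 * b2 + g1 * b1) * l.1 - g2 * c2 * l.2))%:~R + l.1%:~R * T.
Proof.
rewrite /split_alpha.
apply: (eq_comb (n%:R * (l.2%:~R * tau2 - l.1%:~R)) eqe).
apply: (eq_comb (n%:R * (l.1%:~R - l.2%:~R * tau2)) eqbC).
by apply: (eq_comb (n%:R * (l.2 * g2)%:~R) eq2); ring.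
Qed.

Lemma split_alpha_z : alpha * z + beta * tau1 =
  (r * l.2 + s * l.1 - n%:Z * (g1 * c1) * m.2)%:~R + m.1%:~R * T.
Proof.
rewrite /split_alpha /split_beta.
apply: (eq_comb l.1%:~R eqsq); apply: (eq_comb l.2%:~R eqrp).
by apply: (eq_comb (n%:R * (m.2 * g1)%:~R) eq1); ring.
Qed.

Lemma split_phi (u : R[i] * R[i]) : Lam u ->
  exists i j : int, alpha * u.1 + beta * u.2 = i%:~R + j%:~R * T.
Proof.
move=> [x1 [x2 [y1 [y2 ->]]]] /=.
have -> : alpha * (x1%:~R * tau2 + x2%:~R + y1%:~R * z)
     + beta * (y1%:~R * tau1 + y2%:~R)
   = x1%:~R * (alpha * tau2) + x2%:~R * alpha
     + y1%:~R * (alpha * z + beta * tau1) + y2%:~R * beta by ring.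
rewrite split_alpha_tau2 split_alpha_z /split_alpha /split_beta.
have comb (A A' B B' C C' D D' : int) :
    x1%:~R * (A%:~R + A'%:~R * T) + x2%:~R * (B%:~R + B'%:~R * T)
    + y1%:~R * (C%:~R + C'%:~R * T) + y2%:~R * (D%:~R + D'%:~R * T)
  = (x1 * A + x2 * B + y1 * C + y2 * D)%:~R
    + (x1 * A' + x2 * B' + y1 * C' + y2 * D')%:~R * T by ring.
by rewrite comb; do 2!eexists.
Qed.

Local Notation V1 := (x.1%:~R * tau2 + x.2%:~R + y.1%:~R * z).
Local Notation V2 := (y.1%:~R * tau1 + y.2%:~R).

Lemma split_phi_v : alpha * V1 + beta * V2 = 1.
Proof.
have -> : alpha * V1 + beta * V2
   = x.1%:~R * (alpha * tau2) + x.2%:~R * alpha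
     + y.1%:~R * (alpha * z + beta * tau1) + y.2%:~R * beta by ring.
rewrite split_alpha_tau2 split_alpha_z /split_alpha /split_beta.
have l_vC := congr1 (fun k : int => k%:~R : R[i]) l_v.
have l_TvC := congr1 (fun k : int => k%:~R : R[i]) l_Tv.
move: l_TvC; rewrite /mulT1 /mulT2 /mulT3 /mulT4 => l_TvC.
apply: (eq_comb 1 l_TvC).
(* The multiplier of [l(v) = 0] is [- conj(T)]. *)
by apply: (eq_comb ((n%:Z * g1 * b1)%:~R + T) l_vC); ring.
Qed.

Lemma inLambda_phiM (u v : R[i] * R[i]) : Lam u -> Lam v ->
  Lam ((alpha * u.1 + beta * u.2) * v.1, (alpha * u.1 + beta * u.2) * v.2).
Proof.
move=> /split_phi[i [j ->]] Lv.
rewrite !mulrDl -!(mulrA j%:~R).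
apply: (@inLambdaD (_, _) (_, _)); first exact: inLambdaZ.
exact: (@inLambdaZ _ (_, _) (inLambdaT Lv)).
Qed.

(** The vector is [phi(u) v - phi(v) u], which lies in the kernel of phi, the line of
    [(- beta, alpha)]. *)
Lemma inLambda_det (u v : R[i] * R[i]) : Lam u -> Lam v ->
  Lam ((u.1 * v.2 - u.2 * v.1) * - beta, (u.1 * v.2 - u.2 * v.1) * alpha).
Proof.
move=> Lu Lv.
have := inLambdaD (inLambda_phiM Lu Lv)
  (inLambdaZ (-1) (inLambda_phiM Lv Lu)).
by congr Lam; congr pair => /=; ring.
Qed.

Lemma torus2_iso_split : torus2_iso Lam
  (inSumLat (fun o => exists i j : int, o = i%:~R + j%:~R * T)
    (inLatAdjoin (inProdLat (inLat tau1) (inLat tau2)) z)).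
Proof.
have Le1 : Lam (tau2, 0) by exists 1, 0, 0, 0; congr pair; ring.
have Le2 : Lam (1, 0) by exists 0, 1, 0, 0; congr pair; ring.
have Le3 : Lam (z, tau1) by exists 0, 0, 1, 0; congr pair; ring.
have Le4 : Lam (0, 1) by exists 0, 0, 0, 1; congr pair; ring.
have Lv : Lam (V1, V2) by exists x.1, x.2, y.1, y.2.
(* The matrix of [u |-> (phi u, det(v, u))], whose determinant is [phi v = 1]. *)
exists alpha, beta, (- V2), V1; split.
  have -> : alpha * V1 - beta * - V2 = 1 by rewrite -[RHS]split_phi_v; ring.
  exact: oner_neq0.
move=> u; split=> [Lu|[/= [i [j phiE]] [w [k [/inProdLat_inLat wE detE]]]]].
  split; first exact: split_phi.
  have [x1 [x2 [y1 [y2 ->]]]] := Lu; rewrite /= /inLatAdjoin.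
  (* In [det(v, u)] only the pair e3, e4 contributes an integer multiple of [z]; the rest lies in L1
     L2. *)
  exists (V1 * (y1%:~R * tau1 + y2%:~R)
    - V2 * (x1%:~R * tau2 + x2%:~R + y1%:~R * z)
    - (y.1 * y2 - y.2 * y1)%:~R * z), (y.1 * y2 - y.2 * y1); split; last by ring.
  apply/inProdLat_inLat.
  exists (x.2 * y2 - y.2 * x2), (x.2 * y1 - y.1 * x2),
    (x.1 * y2 - y.2 * x1), (x.1 * y1 - y.1 * x1).
  by ring.
have [A [B [C [D wABCD]]]] := wE.
pose det := - V2 * u.1 + V1 * u.2.
(* The inverse map, [u = phi(u) v + det(v, u) (- beta, alpha)], by [phi v = 1]. *)
have uE : u = ((i%:~R + j%:~R * T) * V1 + det * - beta,
               (i%:~R + j%:~R * T) * V2 + det * alpha).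
  rewrite [LHS]surjective_pairing -phiE /det; congr pair.
    by apply: (eq_comb (- u.1) split_phi_v); ring.
  by apply: (eq_comb (- u.2) split_phi_v); ring.
(* The five generators 1, [tau1], [tau2], [tau1 tau2], [z] are determinants of pairs of basis
   vectors, so [inLambda_det] applies to each; [A * 1] keeps the shape uniform. *)
have detABCD : det = A%:~R * 1 + B%:~R * tau1 + C%:~R * tau2
    + D%:~R * (tau1 * tau2) + k%:~R * z.
  by rewrite /det detE wABCD; ring.
have LD a b a' b' : Lam (a, b) -> Lam (a', b') -> Lam (a + a', b + b').
  exact: (@inLambdaD (_, _) (_, _)).
rewrite uE; apply: (LD).
  rewrite !mulrDl -!(mulrA j%:~R); apply: (LD).
    exact: (@inLambdaZ _ (_, _)).
  exact: (@inLambdaZ _ (_, _) (inLambdaT Lv)).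
have Ldet (c : int) a b a' b' t : a * b' - b * a' = t ->
    Lam (a, b) -> Lam (a', b') -> Lam (c%:~R * t * - beta, c%:~R * t * alpha).
  by move=> <- Lab Lab'; rewrite -!mulrA; apply: (@inLambdaZ _ (_, _)
    (inLambda_det Lab Lab')).
rewrite detABCD ![(_ + _) * _]mulrDl; apply: (LD); last first.
  by apply: Ldet Le3 Le4; ring.
apply: (LD); last by apply: Ldet Le1 Le3; ring.
apply: (LD); last by apply: Ldet Le1 Le4; ring.
by apply: (LD); [apply: Ldet Le2 Le4|apply: Ldet Le2 Le3]; ring.
Qed.

End Splitting.

End Extension.

(** * Cofactors of the lcm and conclusion *)

Lemma lcmn_cofactors (f1 f2 : nat) : (0 < f1)%N -> (0 < f2)%N ->
  exists g1 g2 : nat, [/\ lcmn f1 f2 = (g1 * f1)%N, lcmn f1 f2 = (g2 * f2)%N &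
    exists u v : int, u * g1%:Z + v * g2%:Z = 1].
Proof.
move=> f1_gt0 f2_gt0; pose h := gcdn f1 f2.
have h_gt0 : (0 < h)%N by rewrite gcdn_gt0 f1_gt0.
have [g2 f1E] : exists g2, f1 = (g2 * h)%N by apply/dvdnP; apply: dvdn_gcdl.
have [g1 f2E] : exists g1, f2 = (g1 * h)%N by apply/dvdnP; apply: dvdn_gcdr.
have lcmE : (lcmn f1 f2 * h = f1 * f2)%N := muln_lcm_gcd f1 f2.
exists g1, g2; split.
- by apply/eqP; rewrite -(eqn_pmul2r h_gt0) lcmE [in X in X == _]f2E mulnCA mulnA.
- by apply/eqP; rewrite -(eqn_pmul2r h_gt0) lcmE [in X in X == _]f1E mulnAC.
have [u [v uv]] := Bezoutz f1 f2.
have h0 : h%:Z != 0 by rewrite eqz_nat -lt0n.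
exists v, u; apply: (mulfI h0); rewrite mulr1 -[RHS]uv.
by rewrite [in RHS]f1E [in RHS]f2E !PoszM; ring.
Qed.

Theorem theorem2p5 (R : realType) (d : nat) (delta : R[i])
  (tau1 tau2 z : R[i]) (f1 f2 n : nat) :
  (0 < d)%N -> delta ^+ 2 = - d%:R ->
  inQuadField delta tau1 -> inQuadField delta tau2 ->
  tau1 \isn't Num.real -> tau2 \isn't Num.real ->
  has_conductor delta (inLat tau1) f1 -> has_conductor delta (inLat tau2) f2 ->
  torsion_order (inProdLat (inLat tau1) (inLat tau2)) z n ->
  torus2_iso (inLambda tau1 tau2 z)
    (inSumLat (inOrder delta (n * lcmn f1 f2))
              (inLatAdjoin (inProdLat (inLat tau1) (inLat tau2)) z)).
Proof.
move=> _ delta2 K1 K2 nr1 nr2 cond1 cond2 ordz.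
have [w [a1 [b1 [c1 [k1 [a2 [b2 [c2 [k2 [OKE [a10 cop1 eq1 w1E]
  [a20 cop2 eq2 w2E]]]]]]]]]]] := common_basis delta2 K1 K2 nr1 nr2 cond1 cond2.
have [f1_gt0 _] := cond1; have [f2_gt0 _] := cond2.
have [g1 [g2 [f1E f2E copg]]] := lcmn_cofactors f1_gt0 f2_gt0.
have f_gt0 : (0 < lcmn f1 f2)%N by rewrite lcmn_gt0 f1_gt0.
have g10 : g1%:Z != 0.
  by rewrite eqz_nat; apply: contraTneq f_gt0 => g10; rewrite f1E g10.
have g20 : g2%:Z != 0.
  by rewrite eqz_nat; apply: contraTneq f_gt0 => g20; rewrite f2E g20.
have fE : g1%:R * f1%:R = g2%:R * f2%:R :> R[i] by rewrite -!natrM -f1E f2E.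
(* Both [g1 a1 tau1 - g1 k1] and [g2 a2 tau2 - g2 k2] equal [f w]. *)
pose e : int := g1%:Z * k1 - g2%:Z * k2.
have eqe : (g1%:Z * a1)%:~R * tau1 = (g2%:Z * a2)%:~R * tau2 + e%:~R :> R[i].
  apply: (eq_comb g1%:R w1E); apply: (eq_comb (- g2%:R) w2E).
  by apply: (eq_comb w fE); rewrite /e; ring.
have eqb := middle_coef_eq eq1 eq2 eqe nr1 g10 a10.
have [n_gt0 [/inProdLat_inLat[i [j [k [l eqz]]]] _]] := ordz.
have n0 : n%:Z != 0 by rewrite eqz_nat -lt0n.
have aniso (y1 y2 : int) : c1 * y1 ^+ 2 - b1 * y1 * y2 + a1 * y2 ^+ 2 = 0 ->
    y1 = 0 /\ y2 = 0.
  move=> F0.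
  (* The second factor is [a1] times the conjugate of the first, so the form is a multiple of a
     norm. *)
  have : (y2%:~R + y1%:~R * tau1)
       * ((a1 * y2 - b1 * y1)%:~R + (- (a1 * y1))%:~R * tau1) = 0 :> R[i].
    apply: (eq_comb (- y1%:~R ^+ 2) eq1).
    by apply: (eq_comb 1 (congr1 (fun t : int => t%:~R : R[i]) F0)); ring.
  move/eqP; rewrite mulf_eq0 => /orP[] /eqP /nonreal_indep-/(_ nr1) [].
    by move=> -> ->.
  move=> h2 /eqP; rewrite oppr_eq0 mulf_eq0 (negPf a10) /= => /eqP y10.
  split=> //; move/eqP: h2; rewrite y10 mulr0 subr0 mulf_eq0 (negPf a10) /=.
  by move/eqP.
have primP t := ext_primitive eq1 eq2 eqe eqb eqz
  cop1 cop2 copg ordz (t := t).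
have [x [y [l' [m [lv lTv]]]]] :=
  cyclic_vector e cop1 cop2 copg primP n0 g10 g20 aniso.
have [al [be [ga [de [det0 iso]]]]] := torus2_iso_split eq1 eq2 eqe eqb
  (ext_pq eq2 eqe eqb eqz)
  (ext_sq eq1 eqe eqz)
  (ext_rs eq1 eq2 eqe eqb eqz)
  (ext_rp eq1 eq2 eqe eqb eqz) lv lTv.
(* Since [T = n g1 k1 + n f w], the ring Z[T] is O_{nf}. *)
have orderE o : inOrder delta (n * lcmn f1 f2) o <->
    exists i j : int, o = i%:~R + j%:~R * (n%:R * ((g1%:Z * a1)%:~R * tau1)).
  rewrite f1E /inOrder; split=> [[a [_ [/OKE[i' [j' ->]] ->]]]|[i' [j' ->]]].
    exists (a + n%:Z * g1%:Z * (f1%:Z * i' - j' * k1)), j'.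
    by apply: (eq_comb (- (j'%:~R * n%:R * g1%:R)) w1E); ring.
  exists (i' + j' * n%:Z * g1%:Z * k1), (j'%:~R * w); split.
    by apply/OKE; exists 0, j'; rewrite add0r.
  by apply: (eq_comb (j'%:~R * n%:R * g1%:R) w1E); ring.
exists al, be, ga, de; split=> // v; rewrite iso /inSumLat /=.
by split=> -[/orderE o_in w_in].
Qed.
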